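(* Let $G$ be a finite simple graph that is $(P_2\cup P_4)$-free and diamond-free. Then $\chi(G)\le 4$ if $\omega(G)=2$; $\chi(G)\le 7$ if $\omega(G)=3$; $\chi(G)\le 9$ if $\omega(G)=4$; and $\chi(G)\le 2\omega(G)-1$ if $\omega(G)\ge 5$.
   Context: $P_t$ denotes the path on $t$ vertices. For vertex-disjoint graphs $G_1,G_2$, $G_1\cup G_2$ is their disjoint union (no edges between them). A graph $G$ is $H$-free if no induced subgraph of $G$ is isomorphic to $H$. A diamond is the graph obtained from a $P_3$ by adding a new vertex adjacent to all three vertices of the $P_3$ (equivalently, $K_4$ minus an edge). $\chi(G)$ is the chromatic number and $\omega(G)$ the clique number of $G$. *)

(* Defs.v *)
From mathcomp Require Import all_boot.

Set Implicit Arguments.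
Unset Strict Implicit.
Unset Printing Implicit Defensive.

Record sgraph := SGraph {
  vertex :> finType;
  adj : rel vertex;
  adj_sym : symmetric adj;
  adj_irrefl : irreflexive adj
}.

Section Induced.
Variables (G : sgraph) (S : {set G}).

Definition induced_adj : rel {x : G | x \in S} :=
  fun x y => adj (val x) (val y).

Lemma induced_adj_sym : symmetric induced_adj.
Proof. by move=> x y; apply: adj_sym. Qed.

Lemma induced_adj_irrefl : irreflexive induced_adj.
Proof. by move=> x; apply: adj_irrefl. Qed.

Definition induced : sgraph := SGraph induced_adj_sym induced_adj_irrefl.
End Induced.

Definition isomorphic (G H : sgraph) : Prop :=
  exists2 f : G -> H, bijective f & forall x y, adj (f x) (f y) = adj x y.

Definition free_of (H G : sgraph) : Prop :=
  forall S : {set G}, ~ isomorphic (induced S) H.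

Section PathGraph.
Variable t : nat.

Definition path_adj : rel 'I_t := fun i j => (i.+1 == j) || (j.+1 == i).

Lemma path_adj_sym : symmetric path_adj.
Proof. by move=> i j; rewrite /path_adj orbC. Qed.

Lemma path_adj_irrefl : irreflexive path_adj.
Proof. by move=> i; rewrite /path_adj orbb gtn_eqF. Qed.

Definition path_graph : sgraph := SGraph path_adj_sym path_adj_irrefl.
End PathGraph.

Section DisjointUnion.
Variables G1 G2 : sgraph.

Definition dunion_adj : rel (G1 + G2)%type := fun x y =>
  match x, y with
  | inl a, inl b => adj a b
  | inr a, inr b => adj a b
  | _, _ => false
  end.

Lemma dunion_adj_sym : symmetric dunion_adj.
Proof. by move=> [a|a] [b|b] //=; apply: adj_sym. Qed.

Lemma dunion_adj_irrefl : irreflexive dunion_adj.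
Proof. by move=> [a|a] /=; apply: adj_irrefl. Qed.

Definition dunion : sgraph := SGraph dunion_adj_sym dunion_adj_irrefl.
End DisjointUnion.

(* G together with one new vertex [None], adjacent to every vertex of G. *)
Section AddUniversal.
Variable G : sgraph.

Definition add_universal_adj : rel (option G) := fun x y =>
  match x, y with
  | Some a, Some b => adj a b
  | None, None => false
  | _, _ => true
  end.

Lemma add_universal_adj_sym : symmetric add_universal_adj.
Proof. by move=> [a|] [b|] //=; apply: adj_sym. Qed.

Lemma add_universal_adj_irrefl : irreflexive add_universal_adj.
Proof. by move=> [a|] //=; apply: adj_irrefl. Qed.

Definition add_universal : sgraph :=
  SGraph add_universal_adj_sym add_universal_adj_irrefl.
End AddUniversal.

Definition diamond : sgraph := add_universal (path_graph 3).

Definition clique (G : sgraph) (A : {set G}) : bool :=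
  [forall x in A, forall y in A, (x != y) ==> adj x y].

Definition clique_number (G : sgraph) : nat :=
  \max_(A : {set G} | clique A) #|A|.

Definition colorable (G : sgraph) (k : nat) : bool :=
  [exists f : {ffun G -> 'I_k}, forall x, forall y, adj x y ==> (f x != f y)].

Lemma colorable_card (G : sgraph) : exists k, colorable G k.
Proof.
exists #|G|; apply/existsP; exists [ffun x => enum_rank x].
apply/forallP => x; apply/forallP => y; apply/implyP => xy; rewrite !ffunE.
apply/eqP => /enum_rank_inj eq_xy.
by move: xy; rewrite eq_xy adj_irrefl.
Qed.

Definition chromatic_number (G : sgraph) : nat := ex_minn (colorable_card G).

(* Main.v *)
Require Import Defs.
From mathcomp Require Import all_boot.
From mathcomp Require Import zify.

Set Implicit Arguments.
Unset Strict Implicit.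
Unset Printing Implicit Defensive.

(** A proper colouring of a P4-free graph that minimises the sum of the colours
    uses no more colours than the clique number: by minimality every vertex sees
    all smaller colours, and P4-freeness then lets a clique on the colours above
    [i] be extended by a vertex of colour [i].
    Non-neighbours of an edge [v1 v2] induce a P4-free graph, and so does every
    neighbourhood, whose cliques have at most [w - 1] vertices; covering [G] by
    [N(v1)], [N(v2)] and the rest gives [3 w - 2] colours, which settles [w <= 3].
    For [w >= 4] take [v1, v2, v3, v4] in a maximum clique [K].  By
    diamond-freeness a vertex outside [K] has at most one neighbour in [K], so
    the union of [N(v1)] and [N(v2)] minus [K] misses the edge [v3 v4] and is
    P4-free; its cliques have at most [w - 1] vertices, whence [w + (w - 1)]
    colours suffice. *)

(** * Cliques and colourings of vertex sets without induced [P_4] *)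

Section Colourings.
Variable G : sgraph.
Implicit Types (S T Q : {set G}) (k l : nat).

Definition nbhd (v : G) : {set G} := [set x | adj v x].

(** The adjacency pattern forces the four vertices to be distinct: [a = c], say, would make [a]
    adjacent to [d]. *)
Definition P4_free_in S : Prop := forall a b c d,
  a \in S -> b \in S -> c \in S -> d \in S ->
  adj a b -> adj b c -> adj c d ->
  ~~ adj a c -> ~~ adj b d -> ~~ adj a d -> False.

Definition proper_on S (f : G -> nat) : Prop :=
  forall x y, x \in S -> y \in S -> adj x y -> f x <> f y.

(** Colours are natural numbers given on all of [G], so that palettes can be shifted and colourings
    glued; values off [S] do not matter. *)
Definition colorable_on S k : Prop :=
  exists2 f : G -> nat, proper_on S f & forall x, x \in S -> f x < k.

Lemma cliqueP {Q} :
  reflect {in Q &, forall x y, x != y -> adj x y} (clique Q).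
Proof.
apply: (iffP forall_inP) => [h x y xQ yQ xy|h x xQ].
  by have /forall_inP/(_ y yQ)/implyP := h x xQ; apply.
by apply/forall_inP => y yQ; apply/implyP; apply: h.
Qed.

Lemma cliqueU1 v Q :
  clique Q -> {in Q, forall x, adj v x} -> clique (v |: Q).
Proof.
move=> /cliqueP clQ vQ; apply/cliqueP => x y /setU1P[->|xQ] /setU1P[->|yQ].
- by rewrite eqxx.
- by move=> _; apply: vQ.
- by move=> _; rewrite adj_sym; apply: vQ.
- exact: clQ.
Qed.

Lemma clique_card_le Q : clique Q -> #|Q| <= clique_number G.
Proof. by move=> clQ; apply: (@leq_bigmax_cond _ _ (fun A : {set G} => #|A|)). Qed.

Lemma sub_clique {S} Q : Q \subset S -> clique S -> clique Q.
Proof.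
move=> /subsetP sub /cliqueP cl; apply/cliqueP => x y xQ yQ.
by apply: cl; apply: sub.
Qed.

(** If no neighbour of [x] in [S] had the smaller colour [i], recolouring [x] with [i] would stay
    proper and lower the sum of colours. Bounding colours by [#|G|] leaves finitely many colourings,
    among them the numbering of the vertices. *)
Lemma ex_Grundy_coloring S :
  exists2 f : G -> nat, proper_on S f &
    forall x i, x \in S -> i < f x ->
      exists y, [/\ y \in S, adj x y & f y = i].
Proof.
pose ok (f : {ffun G -> 'I_#|G|}) :=
  [forall x in S, forall y in S, adj x y ==> (f x != f y)].
pose f0 : {ffun G -> 'I_#|G|} := [ffun x => enum_rank x].
have ok0 : ok f0.
  apply/forall_inP => x xS; apply/forall_inP => y yS; apply/implyP => xy.
  by rewrite !ffunE; apply: contraL xy => /eqP/enum_rank_inj ->; rewrite adj_irrefl.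
case: (arg_minnP (fun f : {ffun G -> 'I_#|G|} => \sum_x (f x : nat)) ok0).
move=> f okf minf.
have propf x y : x \in S -> y \in S -> adj x y -> f x != f y.
  by move=> xS yS xy; have /forall_inP/(_ y yS)/implyP := forall_inP okf x xS; apply.
exists (fun x => f x : nat) => [x y xS yS xy /ord_inj /eqP|x i xS ifx].
  by apply/negP; apply: propf.
have [/existsP[y /and3P[yS xy /eqP fy]]|/existsPn no] :=
  boolP [exists y, [&& y \in S, adj x y & f y == i :> nat]]; first by exists y.
have iG : i < #|G| by apply: ltn_trans ifx (ltn_ord _).
pose g := [ffun z => if z == x then Ordinal iG else f z].
suff /minf : ok g.
  rewrite (bigD1 x) //= [X in _ <= X](bigD1 x) //= ffunE eqxx /=.
  rewrite [X in _ <= _ + X](eq_bigr (fun z => f z : nat)) => [|z /negbTE zx]; last first.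
    by rewrite ffunE zx.
  by rewrite leq_add2r leqNgt ifx.
have new z : z \in S -> adj x z -> f z != Ordinal iG.
  by move=> zS xz; move: (no z); rewrite zS xz.
apply/forall_inP => y yS; apply/forall_inP => z zS; apply/implyP => yz.
rewrite !ffunE; case: (eqVneq y x) yz => [->|_]; case: (eqVneq z x) => [->|_].
- by rewrite adj_irrefl.
- by move=> xz; rewrite eq_sym new.
- by rewrite adj_sym; apply: new.
- exact: propf.
Qed.

(** Take [p] of colour [i] with the most neighbours in [Q]. If [p] misses [q], let [p'] be a
    neighbour of [q] of colour [i]; by maximality some [q'] in [Q] sees [p] but not [p'], and [p],
    [q'], [q], [p'] is an induced [P_4]. *)
Lemma P4_free_extend_clique S (f : G -> nat) Q i :
  P4_free_in S -> proper_on S f -> Q \subset S -> clique Q -> Q != set0 ->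
  (forall q, q \in Q -> exists y, [/\ y \in S, adj q y & f y = i]) ->
  exists p, [/\ p \in S, f p = i & {in Q, forall q, adj p q}].
Proof.
move=> P4S propf /subsetP QS /cliqueP clQ /set0Pn[q0 q0Q] nbr.
have [p0 [p0S _ fp0]] := nbr q0 q0Q.
pose ok p := (p \in S) && (f p == i).
have ok0 : ok p0 by rewrite /ok p0S fp0 eqxx.
case: (arg_maxnP (fun p => #|Q :&: nbhd p|) ok0) => p /andP[pS /eqP fp] maxp.
exists p; split=> // q qQ; apply: contraT => npq.
have [p' [p'S qp' fp']] := nbr q qQ.
have {maxp}le : #|Q :&: nbhd p'| <= #|Q :&: nbhd p|.
  by apply: maxp; rewrite /ok p'S fp' eqxx.
have /subsetPn[q'] : ~~ (Q :&: nbhd p \subset Q :&: nbhd p').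
  apply/negP => sub.
  have : Q :&: nbhd p \proper Q :&: nbhd p'.
    apply/properP; split=> //; exists q; rewrite !inE qQ ?(negbTE npq) //.
    by rewrite adj_sym.
  by move/proper_card; lia.
rewrite !inE => /andP[q'Q pq']; rewrite q'Q /= => np'q'.
exfalso; apply: (P4S p q' q p') => //; try exact: QS.
- by apply: clQ => //; apply: contraNneq npq => <-.
- by rewrite adj_sym.
- by apply/negP => /(propf _ _ pS p'S); rewrite fp fp'.
Qed.

Lemma P4_free_colorable_on S k :
  P4_free_in S -> (forall Q, Q \subset S -> clique Q -> #|Q| <= k) ->
  colorable_on S k.
Proof.
move=> P4S clk; have [f propf grundy] := ex_Grundy_coloring S.
exists f => // x xS.
(* The clique grows downwards from the colour of [x]; at [j = f x] it has [f x + 1] vertices, so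
   [f x < k]. *)
suff /(_ (f x) (leqnn _))[Q [QS clQ cardQ _]] : forall j, j <= f x ->
    exists Q, [/\ Q \subset S, clique Q, #|Q| = j.+1 &
                  {in Q, forall q, f x - j <= f q}].
  by rewrite -cardQ; apply: clk.
elim=> [_|j IH jx].
  exists [set x]; split; rewrite ?sub1set ?cards1 //.
    by apply/cliqueP => y z /set1P-> /set1P->; rewrite eqxx.
  by move=> q /set1P->; rewrite subn0.
have [Q [QS clQ cardQ fQ]] := IH (ltnW jx).
have Q0 : Q != set0 by rewrite -card_gt0 cardQ.
have nbr q : q \in Q -> exists y, [/\ y \in S, adj q y & f y = f x - j.+1].
  by move=> qQ; apply: grundy; [apply: (subsetP QS) | have := fQ q qQ; lia].
have [p [pS fp pQ]] := P4_free_extend_clique P4S propf QS clQ Q0 nbr.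
exists (p |: Q); split.
- by rewrite subUset sub1set pS.
- exact: cliqueU1.
- rewrite cardsU1 cardQ; case: (boolP (p \in Q)) => // /pQ.
  by rewrite adj_irrefl.
- by move=> q /setU1P[->|/fQ]; rewrite ?fp //; lia.
Qed.

(** * Colouring cliques, unions and the whole graph *)

Lemma clique_colorable_on Q k : clique Q -> #|Q| <= k -> colorable_on Q k.
Proof.
move=> clQ Qk; apply: P4_free_colorable_on => [a b c d aQ bQ cQ dQ ab bc cd nac nbd nad|T TQ _].
  have ac : a != c by apply: contraNneq nad => ->.
  by move: nac; rewrite (cliqueP clQ).
exact: leq_trans (subset_leq_card TQ) Qk.
Qed.

Lemma colorable_onU S T k l :
  colorable_on S k -> colorable_on T l -> colorable_on (S :|: T) (k + l).
Proof.
move=> [f propf fk] [g propg gl].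
exists (fun x => if x \in S then f x else k + g x) => [x y|x]; rewrite !inE.
  case: (boolP (x \in S)) => xS; case: (boolP (y \in S)) => yS //= xT yT xy.
  - exact: propf.
  - by have := fk x xS; lia.
  - by have := fk y yS; lia.
  - by have := propg x y xT yT xy; lia.
by case: (boolP (x \in S)) => /= [/fk|_ /gl]; lia.
Qed.

Lemma colorable_onU_anticomplete S T k :
  {in S & T, forall x y, ~~ adj x y} ->
  colorable_on S k -> colorable_on T k -> colorable_on (S :|: T) k.
Proof.
move=> anti [f propf fk] [g propg gk].
exists (fun x => if x \in S then f x else g x) => [x y|x]; rewrite !inE.
  case: (boolP (x \in S)) => xS; case: (boolP (y \in S)) => yS //= xT yT xy.
  - exact: propf.
  - by move: (anti x y xS yT); rewrite xy.
  - by move: (anti y x yS xT); rewrite adj_sym xy.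
  - exact: propg.
by case: (boolP (x \in S)) => /= [/fk|_ /gk].
Qed.

Lemma chromatic_number_le k : colorable_on setT k -> chromatic_number G <= k.
Proof.
move=> [f propf fk]; rewrite /chromatic_number; case: ex_minnP => m _; apply.
apply/existsP; exists [ffun x => Ordinal (fk x (in_setT x))].
apply/forallP => x; apply/forallP => y; apply/implyP => xy; rewrite !ffunE.
by rewrite -val_eqE; apply/eqP; apply: propf; rewrite ?in_setT.
Qed.

Lemma max_clique : exists2 K : {set G}, clique K & #|K| = clique_number G.
Proof.
have cl0 : clique (set0 : {set G}) by apply/cliqueP => x y; rewrite inE.
have gt0 : 0 < #|[pred A : {set G} | clique A]| by apply/card_gt0P; exists set0.
by have [K clK cardK] := eq_bigmax_cond (fun A : {set G} => #|A|) gt0; exists K.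
Qed.

End Colourings.

(** Onto its image, which has at most [#|H|] vertices, the injective [g] is a bijection; its inverse
    is the isomorphism that [free_of] forbids. *)
Lemma free_of_embedding (H G : sgraph) (g : H -> G) :
  free_of H G -> injective g -> (forall x y, adj (g x) (g y) = adj x y) -> False.
Proof.
move=> frH inj_g adj_g; apply: (frH (g @: setT)).
have gP x : g x \in g @: setT by apply: imset_f; rewrite inE.
pose h x : induced (g @: setT) := exist _ (g x) (gP x).
have inj_h : injective h by move=> x y /(congr1 val) /inj_g.
have cardI : #|induced (g @: setT)| <= #|H|.
  by rewrite card_sig; apply: leq_trans (leq_imset_card _ _) _; rewrite cardsT.
have [f hK fK] := inj_card_bij inj_h cardI.
by exists f => [|x y]; [exists h | rewrite -adj_g -{2}[x]fK -{2}[y]fK].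
Qed.

(** * Neighbourhoods and non-neighbours under the two exclusions *)

Section Excluded.
Variable G : sgraph.
Hypothesis hP : free_of (dunion (path_graph 2) (path_graph 4)) G.
Hypothesis hD : free_of diamond G.
Local Notation w := (clique_number G).

(** Otherwise [x], [b], [y] is an induced [P_3] and [a] is adjacent to all of it. *)
Lemma diamond_free (a b x y : G) :
  adj a b -> adj a x -> adj b x -> adj a y -> adj b y -> x != y -> adj x y.
Proof.
move=> ab ax bx ay by_ xy; apply: contraT => nxy; exfalso.
pose g (o : diamond) : G := if o is Some i then nth a [:: x; b; y] i else a.
have E u v : (adj u v = adj v u) := adj_sym u v.
have I u : adj u u = false := adj_irrefl u.
have ne u v : adj u v -> u <> v by move=> uv eq_uv; rewrite eq_uv I in uv.
apply: (free_of_embedding (g := g) hD).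
  by case=> [[[|[|[|?]]] ?]|]; case=> [[[|[|[|?]]] ?]|] //= eq_g;
    try (by congr Some; apply: val_inj); exfalso;
    first [ by move: eq_g; apply: ne | by move/esym: eq_g; apply: ne
          | by move/eqP: xy; apply | by move/eqP: xy; rewrite eq_g ].
by case=> [[[|[|[|?]]] ?]|]; case=> [[[|[|[|?]]] ?]|] //=; rewrite ?I //;
  first [ by rewrite ?ab ?ax ?bx ?ay ?by_ ?(negbTE nxy)
        | by rewrite E ?ab ?ax ?bx ?ay ?by_ ?(negbTE nxy) ].
Qed.

Lemma P4_free_in_nonnbhd (u v : G) :
  adj u v -> P4_free_in (~: (nbhd u :|: nbhd v)).
Proof.
move=> uv a b c d; rewrite !inE !negb_or.
move=> /andP[/negbTE ua /negbTE va] /andP[/negbTE ub /negbTE vb].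
move=> /andP[/negbTE uc /negbTE vc] /andP[/negbTE ud /negbTE vd].
move=> ab bc cd /negbTE ac /negbTE bd /negbTE ad.
pose g (o : dunion (path_graph 2) (path_graph 4)) : G :=
  match o with inl i => nth u [:: u; v] i | inr i => nth u [:: a; b; c; d] i end.
have E x y : (adj x y = adj y x) := adj_sym x y.
have adj_g : forall x y, adj (g x) (g y) = adj x y.
  by case=> [[[|[|?]] ?]|[[|[|[|[|?]]]] ?]]; case=> [[[|[|?]] ?]|[[|[|[|[|?]]]] ?]] //=;
    rewrite ?adj_irrefl //;
    first [ by rewrite ?(uv, ua, va, ub, vb, uc, vc, ud, vd, ab, bc, cd, ac, bd, ad)
          | by rewrite E ?(uv, ua, va, ub, vb, uc, vc, ud, vd, ab, bc, cd, ac, bd, ad) ].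
(* [P2 + P4] has no two vertices with equal neighbourhoods. *)
have inj_g : injective g.
  move=> x y eq_g.
  have {adj_g eq_g} : forall z, adj x z = adj y z by move=> z; rewrite -!adj_g eq_g.
  pose l i (hi : i < 2) : dunion (path_graph 2) (path_graph 4) := inl (Ordinal hi).
  pose r i (hi : i < 4) : dunion (path_graph 2) (path_graph 4) := inr (Ordinal hi).
  move=> eqN; move: (eqN (l 0 isT)) (eqN (l 1 isT)).
  move: (eqN (r 0 isT)) (eqN (r 1 isT)) (eqN (r 2 isT)) (eqN (r 3 isT)) => {eqN}.
  by case: x => [[[|[|?]] ?]|[[|[|[|[|?]]]] ?]]; case: y => [[[|[|?]] ?]|[[|[|[|[|?]]]] ?]] //= *;
    (congr inl || congr inr); apply: val_inj.
exact: free_of_embedding hP inj_g adj_g.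
Qed.

Lemma colorable_on_nonnbhd (u v : G) :
  adj u v -> colorable_on (~: (nbhd u :|: nbhd v)) w.
Proof.
move=> uv; apply: P4_free_colorable_on; first exact: P4_free_in_nonnbhd.
by move=> Q _; apply: clique_card_le.
Qed.

Lemma clique_in_nbhd (v : G) (Q : {set G}) :
  clique Q -> Q \subset nbhd v -> #|Q| <= w.-1.
Proof.
move=> clQ /subsetP Qv.
have vQ : v \notin Q by apply/negP => /Qv; rewrite inE adj_irrefl.
have /clique_card_le : clique (v |: Q) by apply: cliqueU1 => // x /Qv; rewrite inE.
by rewrite cardsU1 vQ; lia.
Qed.

(** Even an induced [P_3] is impossible inside [nbhd v], since [v] would complete it to a
    diamond. *)
Lemma colorable_on_nbhd (v : G) : colorable_on (nbhd v) w.-1.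
Proof.
apply: P4_free_colorable_on => [a b c d|Q Qv clQ]; last exact: clique_in_nbhd clQ Qv.
rewrite !inE => va vb vc vd ab bc cd nac nbd nad.
have ac : a != c by apply: contraNneq nad => ->.
by move: nac; rewrite (@diamond_free v b a c) // adj_sym.
Qed.

(** * Colour bounds from an edge and from a maximum clique *)

Lemma chromatic_number_le_edge (u v : G) :
  adj u v -> chromatic_number G <= w.-1 + w.-1 + w.
Proof.
move=> uv; apply: chromatic_number_le.
rewrite -(setUCr (nbhd u :|: nbhd v)).
apply: colorable_onU; last exact: colorable_on_nonnbhd.
by apply: colorable_onU; apply: colorable_on_nbhd.
Qed.

(** If [u] and [v] differ, every other vertex of [K] is, like [x], a common neighbour of both, hence
    adjacent to [x]; then [x |: K] is a clique larger than [w]. *)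
Lemma nbr_max_clique_uniq (K : {set G}) (x u v : G) :
  clique K -> #|K| = w -> x \notin K -> u \in K -> v \in K ->
  adj u x -> adj v x -> u = v.
Proof.
move=> clK cardK xK uK vK ux vx; apply/eqP/contraT => uv.
have adjK := cliqueP clK.
have /clique_card_le : clique (x |: K).
  apply: cliqueU1 => // y yK.
  have [->|yu] := eqVneq y u; first by rewrite adj_sym.
  have [->|yv] := eqVneq y v; first by rewrite adj_sym.
  apply: (@diamond_free u v) => //; try by apply: adjK => //; rewrite eq_sym.
  by apply: contraNneq xK => ->.
by rewrite cardsU1 xK cardK; lia.
Qed.

(** When [Q] has three or more vertices, one of [u], [v], say [u], sees two of them, [x] and [y].
    Any other vertex of [Q] is, like [u], a common neighbour of [x] and [y], hence adjacent to [u];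
    so [Q] lies in [nbhd u]. *)
Lemma clique_in_nbhdU (u v : G) (Q : {set G}) :
  clique Q -> Q \subset (nbhd u :|: nbhd v) -> u \notin Q -> v \notin Q ->
  3 <= w -> #|Q| <= w.-1.
Proof.
move=> clQ Quv uQ vQ w3; have [|Q3] := leqP #|Q| 2; first lia.
have adjQ := cliqueP clQ.
wlog lt1 : u v Quv uQ vQ / 1 < #|Q :&: nbhd u|.
  move=> wl; have [|le1] := ltnP 1 #|Q :&: nbhd u|; first exact: (wl u v).
  apply: (wl v u) => //; first by rewrite setUC.
  have : #|Q| <= #|Q :&: nbhd u| + #|Q :&: nbhd v|.
    rewrite -{1}(setIidPl Quv) setIUr; exact: leq_card_setU.
  lia.
have /card_gt1P[x [y []]] := lt1.
rewrite !inE => /andP[xQ ux] /andP[yQ uy] xy.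
apply: (@clique_in_nbhd u) => //; apply/subsetP => z zQ; rewrite inE.
have [->//|zx] := eqVneq z x; have [->//|zy] := eqVneq z y.
apply: (@diamond_free x y); try by [apply: adjQ => //; rewrite eq_sym | rewrite adj_sym].
by apply: contraNneq uQ => ->.
Qed.

Lemma chromatic_number_le_max_clique :
  4 <= w -> chromatic_number G <= w + w.-1.
Proof.
move=> w4; have [K clK cardK] := max_clique G.
have adjK := cliqueP clK.
have /card_gt1P[v1 [v2 [v1K v2K v12]]] : 1 < #|K| by rewrite cardK; apply: leq_trans w4.
have subK : [set v1; v2] \subset K by rewrite subUset !sub1set v1K.
have cardR : #|K :\: [set v1; v2]| = w - 2.
  by rewrite cardsD (setIidPr subK) cards2 v12 cardK.
have /card_gt1P[v3 [v4 [v3R v4R v34]]] : 1 < #|K :\: [set v1; v2]|.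
  by rewrite cardR; case: (w) w4 => [|[|[|[|]]]].
move: v3R v4R; rewrite !inE !negb_or => /andP[/andP[v31 v32] v3K] /andP[/andP[v41 v42] v4K].
have e12 : adj v1 v2 by apply: adjK.
have e34 : adj v3 v4 by apply: adjK.
pose N := nbhd v1 :|: nbhd v2.
(* A vertex of [N] outside [K] has [v1] or [v2] as its only neighbour in [K], so it misses the rest
   of [K], including the edge [v3 v4]. *)
have far v x : v \in K -> v != v1 -> v != v2 -> x \in N :\: K -> ~~ adj v x.
  move=> vK vv1 vv2; rewrite !inE => /andP[xK xN]; apply/negP => vx.
  have uniqK := nbr_max_clique_uniq clK cardK xK.
  case/orP: xN => [v1x|v2x].
  - by move/eqP: vv1; apply; apply: uniqK.
  - by move/eqP: vv2; apply; apply: uniqK.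
have colN : colorable_on (N :\: K) w.-1.
  apply: P4_free_colorable_on => [a b c d aN bN cN dN|Q /subsetP QN clQ].
    by apply: (P4_free_in_nonnbhd e34); rewrite !inE !negb_or !far.
  apply: (@clique_in_nbhdU v1 v2) => //; last exact: ltnW.
  - by apply/subsetP => x /QN; rewrite inE => /andP[].
  - by apply/negP => /QN; rewrite inE v1K.
  - by apply/negP => /QN; rewrite inE v2K.
have colR : colorable_on (K :\: [set v1; v2]) w.-1.
  apply: clique_colorable_on; first exact: sub_clique (subsetDl _ _) clK.
  by rewrite cardR -subn1 leq_sub2l.
have col12 : colorable_on [set v1; v2] w.
  apply: clique_colorable_on; first exact: sub_clique subK clK.
  by rewrite cards2 v12; apply: leq_trans w4.
apply: chromatic_number_le.
(* The two sets in each inner union have no edges between them, so they share a palette: [w] colours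
   for the first pair, [w.-1] for the second. *)
have -> : [set: G] = (~: N :|: [set v1; v2]) :|: ((N :\: K) :|: (K :\: [set v1; v2])).
  apply/setP => x; rewrite !inE.
  by case: (x == v1); case: (x == v2); case: (adj v1 x); case: (adj v2 x); case: (x \in K).
apply: colorable_onU; apply: colorable_onU_anticomplete => //.
- move=> x y; rewrite !inE negb_or => /andP[v1x v2x] /orP[]/eqP->;
  by rewrite adj_sym.
- exact: colorable_on_nonnbhd.
- move=> x y xN; rewrite !inE negb_or => /andP[/andP[yv1 yv2] yK].
  by rewrite adj_sym; apply: far.
Qed.

End Excluded.

Theorem theorem1p3 (G : sgraph)
    (hP : free_of (dunion (path_graph 2) (path_graph 4)) G)
    (hD : free_of diamond G) :
  [/\ clique_number G = 2 -> chromatic_number G <= 4,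
      clique_number G = 3 -> chromatic_number G <= 7,
      clique_number G = 4 -> chromatic_number G <= 9
    & 5 <= clique_number G ->
      chromatic_number G <= 2 * clique_number G - 1].
Proof.
have small : 2 <= clique_number G -> chromatic_number G <= 3 * clique_number G - 2.
  have [K /cliqueP clK cardK] := max_clique G; rewrite -{1}cardK.
  move=> /card_gt1P[u [v [uK vK uv]]].
  by have := chromatic_number_le_edge hP hD (clK u v uK vK uv); lia.
(* [small] yields 4 and 7 for clique numbers 2 and 3; from 4 on [large] yields twice the clique
   number minus 1, which is 7 at 4, within the bound 9. *)
by have large := @chromatic_number_le_max_clique G hP hD; split; lia.
Qed.
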